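(* For every non-compact semisimple symmetric pair equipped with a Cartan involution $(\mathfrak{g}_0,\sigma;\theta)$, the following relations hold: $$(\mathfrak{g}_0,\sigma;\theta)^{a*}=(\mathfrak{g}_0,\sigma;\theta)^{*a},\qquad (\mathfrak{g}_0,\sigma;\theta)^{d*}=(\mathfrak{g}_0,\sigma;\theta)^{*d}.$$ (Superscripts are applied from left to right, e.g. $x^{a*}=(x^a)^*$.)
   Context: An involution on a real Lie algebra $\mathfrak{l}$ is an automorphism $\nu$ with $\nu^2=\operatorname{id}$; $\mathfrak{l}^{\pm\nu}$ are its $(\pm1)$-eigenspaces. Involutions are extended $\mathbb{C}$-linearly to complexifications and restricted to real forms, keeping the same letter; the complexification of a real form of $(\mathfrak{g}_0)_{\mathbb{C}}$ is identified with $(\mathfrak{g}_0)_{\mathbb{C}}$. A non-compact semisimple symmetric pair equipped with a Cartan involution $(\mathfrak{g}_0,\sigma;\theta)$ consists of a non-compact real semisimple Lie algebra $\mathfrak{g}_0$, an involution $\sigma$ on it, and a Cartan involution $\theta$ of $\mathfrak{g}_0$ with $\theta\sigma=\sigma\theta$. Its associated pair is $(\mathfrak{g}_0,\sigma;\theta)^a:=(\mathfrak{g}_0,\theta\sigma;\theta)$ and its dual pair is $(\mathfrak{g}_0,\sigma;\theta)^d:=(\mathfrak{g}_0^d,\theta;\sigma)$, where $\mathfrak{g}_0^d:=(\mathfrak{g}_0)_{\mathbb{C}}^{\mu\sigma}$ is the fixed point set of $\mu\sigma$, with $\mu$ the complex conjugation of $(\mathfrak{g}_0)_{\mathbb{C}}$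 with respect to the compact real form $\mathfrak{g}_0^{\theta}+\sqrt{-1}\,\mathfrak{g}_0^{-\theta}$. A commutative compact semisimple symmetric triad $(\mathfrak{g},\theta_1,\theta_2)$ consists of a compact semisimple Lie algebra $\mathfrak{g}$ and involutions $\theta_1,\theta_2$ on $\mathfrak{g}$ with $\theta_1\theta_2=\theta_2\theta_1$. Its associated triad is $(\mathfrak{g},\theta_1,\theta_2)^a:=(\mathfrak{g},\theta_1,\theta_1\theta_2)$ and its dual triad is $(\mathfrak{g},\theta_1,\theta_2)^d:=(\mathfrak{g},\theta_2,\theta_1)$. The duality $*$ from pairs equipped with Cartan involutions to triads is $(\mathfrak{g}_0,\sigma;\theta)^*:=(\mathfrak{g}_0^{\theta}+\sqrt{-1}\,\mathfrak{g}_0^{-\theta},\ \theta,\ \sigma)$. *)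

(* Defs.v *)
From HB Require Import structures.
From mathcomp Require Import all_boot all_order all_algebra.
From mathcomp Require Import boolp reals.

Set Implicit Arguments.
Unset Strict Implicit.
Unset Printing Implicit Defensive.

Import Order.TTheory GRing.Theory Num.Theory.
Local Open Scope ring_scope.

HB.mixin Record Vector_isLieAlgebra (K : fieldType) V of Vector K V := {
  lie : V -> V -> V;
  lie_linearl : forall (a : K) (x y z : V),
    lie (a *: x + y) z = a *: lie x z + lie y z;
  lie_linearr : forall (a : K) (x y z : V),
    lie x (a *: y + z) = a *: lie x y + lie x z;
  liexx : forall x : V, lie x x = 0;
  lie_jacobi : forall x y z : V,
    lie x (lie y z) + lie y (lie z x) + lie z (lie x y) = 0
}.

#[short(type="lieAlgType")]
HB.structure Definition LieAlgebra (K : fieldType) :=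
  {V of Vector K V & Vector_isLieAlgebra K V}.

Section LieTheory.
Variables (K : fieldType) (g : lieAlgType K).
Implicit Types (x y z : g) (I U V W : {vspace g}).

HB.instance Definition _ x :=
  GRing.isSemilinear.Build K g g _ (@lie K g x)
    (GRing.semilinear_linear (fun a => lie_linearr a x)).

Lemma lieDl x y z : lie (x + y) z = lie x z + lie y z.
Proof. by have := lie_linearl 1 x y z; rewrite !scale1r. Qed.

Lemma lie0l x : lie 0 x = 0.
Proof. by apply: (addIr (lie 0 x)); rewrite -lieDl !add0r. Qed.

Lemma lieZl (a : K) x y : lie (a *: x) y = a *: lie x y.
Proof. by rewrite -[a *: x]addr0 lie_linearl lie0l addr0. Qed.

Lemma lieNl x y : lie (- x) y = - lie x y.
Proof. by rewrite -scaleN1r lieZl scaleN1r. Qed.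

Lemma lie_anti x y : lie x y = - lie y x.
Proof.
apply/eqP; rewrite -subr_eq0 opprK; apply/eqP.
by have := liexx (x + y); rewrite lieDl !linearD /= !liexx add0r addr0.
Qed.

Definition ad x : 'End(g) := linfun (lie x).

Lemma adE x y : ad x y = lie x y. Proof. by rewrite lfunE. Qed.

Definition lie_prod U V : {vspace g} :=
  <<[seq lie u v | u <- vbasis U, v <- vbasis V]>>%VS.

Lemma mem_lie_prod U V x y : x \in U -> y \in V -> lie x y \in lie_prod U V.
Proof.
move=> /coord_vbasis-> /coord_vbasis->.
rewrite linear_sum; apply: memv_suml => j _; rewrite linearZ /=; apply: memvZ.
rewrite lie_anti memvN linear_sum; apply: memv_suml => i _.
rewrite linearZ /=; apply: memvZ; rewrite lie_anti memvN memv_span //.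
by apply/allpairsP; exists ((vbasis U)`_i, (vbasis V)`_j); rewrite !memt_nth.
Qed.

Lemma lie_prodP U V W :
  reflect (forall x y, x \in U -> y \in V -> lie x y \in W)
          (lie_prod U V <= W)%VS.
Proof.
apply: (iffP idP) => [/subvP sUVW x y xU yV | UVW].
  by apply: sUVW; exact: mem_lie_prod.
apply/span_subvP=> _ /allpairsP[[u v] /= [Uu Vv ->]].
by apply: UVW; exact: vbasis_mem.
Qed.

Definition lie_ideal I := forall x y, y \in I -> lie x y \in I.

Definition solvable I :=
  exists n : nat, iter n (fun U => lie_prod U U) I = 0%VS.

Definition semisimple := forall I, lie_ideal I -> solvable I -> I = 0%VS.

End LieTheory.

Section Trace.
Variable K : fieldType.

(* The trace does not depend on the basis in which the matrix is taken, see
   [lftrace_comp]. *)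
Definition lftrace (V : vectType K) (f : 'End(V)) : K :=
  \tr (passmx.mxof (vbasis {:V}) (vbasis {:V}) f).

Lemma lftrace_comp (U V : vectType K) (f : 'Hom(U, V)) (h : 'Hom(V, U)) :
  lftrace (f \o h)%VF = lftrace (h \o f)%VF.
Proof.
rewrite /lftrace (passmx.mxof_comp _ _ (vbasisP {:U})).
by rewrite (passmx.mxof_comp _ _ (vbasisP {:V})) mxtrace_mulC.
Qed.

Lemma lftraceP (V : vectType K) (a : K) (f h : 'End(V)) :
  lftrace (a *: f + h) = a * lftrace f + lftrace h.
Proof.
by rewrite /lftrace passmx.mxof_linear mxtraceD -[in RHS]mxtraceZ.
Qed.

Lemma lftraceD (V : vectType K) (f h : 'End(V)) :
  lftrace (f + h) = lftrace f + lftrace h.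
Proof. by rewrite -{1}[f]scale1r lftraceP mul1r. Qed.

Lemma lftrace0 (V : vectType K) : lftrace (0 : 'End(V)) = 0.
Proof. by apply: (addIr (lftrace (0 : 'End(V)))); rewrite -lftraceD !add0r. Qed.

Lemma lftraceN (V : vectType K) (f : 'End(V)) : lftrace (- f) = - lftrace f.
Proof. by apply/eqP; rewrite -addr_eq0 -lftraceD addNr lftrace0. Qed.

End Trace.

Section Killing.
Variables (K : fieldType) (g : lieAlgType K).

Definition killing (x y : g) : K := lftrace (ad x \o ad y)%VF.

Lemma killingC x y : killing x y = killing y x.
Proof. exact: lftrace_comp. Qed.

Lemma killingDr x y z : killing x (y + z) = killing x y + killing x z.
Proof.
rewrite /killing -lftraceD; congr lftrace; apply/lfunP => v.
by rewrite add_lfunE !comp_lfunE !adE lieDl linearD.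
Qed.

Lemma killingDl x y z : killing (y + z) x = killing y x + killing z x.
Proof. by rewrite ![killing _ x]killingC killingDr. Qed.

Lemma killing0r x : killing x 0 = 0.
Proof. by apply: (addIr (killing x 0)); rewrite -killingDr !add0r. Qed.

Lemma killingNr x y : killing x (- y) = - killing x y.
Proof.
rewrite /killing -lftraceN; congr lftrace; apply/lfunP => v.
by rewrite opp_lfunE !comp_lfunE !adE lieNl linearN.
Qed.

Lemma killing_abelian_ideal (I : {vspace g}) x y :
  lie_ideal I -> lie_prod I I = 0%VS -> x \in I -> killing x y = 0.
Proof.
move=> Iid I0 xI; pose i : 'Hom(subvs_of I, g) := linfun vsval.
pose p : 'Hom(g, subvs_of I) := linfun (vsproj I).
have e : (ad x \o ad y = i \o (p \o (ad x \o ad y)))%VF.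
  apply/lfunP=> z; do !rewrite ?comp_lfunE ?lfunE /=.
  by rewrite vsprojK // lie_anti memvN Iid.
rewrite /killing e lftrace_comp (_ : (_ \o i)%VF = 0) ?lftrace0 //.
apply/lfunP=> z; do !rewrite ?comp_lfunE ?lfunE /=.
suff -> : lie x (lie y (vsval z)) = 0 by rewrite linear0.
by apply/eqP; rewrite -memv0 -I0 mem_lie_prod // Iid // subvsP.
Qed.

Lemma nondegenerate_semisimple :
  (forall x : g, x != 0 -> exists y, killing x y != 0) -> semisimple g.
Proof.
move=> nd.
have abelian0 (I : {vspace g}) :
    lie_ideal I -> lie_prod I I = 0%VS -> I = 0%VS.
  move=> Iid I0; apply/eqP; rewrite -subv0; apply/subvP => x xI.
  rewrite memv0; apply: contraT => /nd[y].
  by rewrite (killing_abelian_ideal y Iid I0 xI) eqxx.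
move=> I Iid [n]; elim: n I Iid => [//|n IHn] I Iid; rewrite iterSr => In.
apply: abelian0 => //; apply: IHn => // x y yI.
pose W := (ad x @^-1: lie_prod I I)%VS.
suff /subvP/(_ y yI) : (lie_prod I I <= W)%VS by rewrite -memv_preim adE.
apply/lie_prodP => u v uI vI; rewrite -memv_preim adE.
have -> : lie x (lie u v) = lie u (lie x v) + lie (lie x u) v.
  have := lie_jacobi x u v; rewrite (lie_anti v x) (lie_anti v) linearN /=.
  by move/eqP; rewrite -addrA -opprD subr_eq0 => /eqP.
by rewrite memvD // mem_lie_prod // Iid.
Qed.

End Killing.

Section RealLie.
Variables (R : realType) (g : lieAlgType R).
Implicit Types nu theta : 'End(g).

(* Compactness in the sense used for semisimple Lie algebras; an abelian
   Lie algebra of positive dimension is excluded. *)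
Definition compact_lie := forall x : g, x != 0 -> killing x x < 0.

Definition involution nu :=
  (forall x y : g, nu (lie x y) = lie (nu x) (nu y)) /\ (nu \o nu = \1)%VF.

Definition cartan_involution theta :=
  involution theta /\ forall x : g, x != 0 -> 0 < - killing x (theta x).

End RealLie.
Arguments compact_lie {R} g.

(* A complex Lie algebra is given by its underlying real Lie algebra together
   with the multiplication [muli] by the imaginary unit; this makes its real
   subspaces available as [{vspace L}]. *)
HB.mixin Record LieAlgebra_isComplex (R : realType) L of LieAlgebra R L := {
  muli : 'End(L);
  muliK : forall x : L, muli (muli x) = - x;
  lie_mulil : forall x y : L, lie (muli x) y = muli (lie x y)
}.

#[short(type="complexLieAlgType")]
HB.structure Definition ComplexLieAlgebra (R : realType) :=
  {L of LieAlgebra R L & LieAlgebra_isComplex R L}.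

Section RealForm.
Variables (R : realType) (L : complexLieAlgType R).
Local Notation iL := (@muli R L).

Definition is_real_form (V : {vspace L}) : bool :=
  [&& (lie_prod V V <= V)%VS,
      (V + iL @: V == fullv)%VS & (V :&: iL @: V == 0)%VS].

Record realForm :=
  RealForm { form_space :> {vspace L}; form_spaceP : is_real_form form_space }.

Definition form_alg (V : realForm) : Type := subvs_of V.
HB.instance Definition _ (V : realForm) := Vector.on (form_alg V).

Lemma form_closed (V : realForm) x y : x \in V -> y \in V -> lie x y \in V.
Proof. by case: V => V /= /and3P[/lie_prodP VV _ _]; exact: VV. Qed.

Lemma form_cap (V : realForm) : (V :&: iL @: V = 0)%VS.
Proof. by case: V => V /= /and3P[_ _ /eqP]. Qed.

Lemma form_full (V : realForm) : (V + iL @: V = fullv)%VS.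
Proof. by case: V => V /= /and3P[_ /eqP]. Qed.

Section FormLie.
Variable V : realForm.

Definition form_lie (x y : form_alg V) : form_alg V :=
  vsproj V (lie (vsval x) (vsval y)).

Lemma form_lieE x y : vsval (form_lie x y) = lie (vsval x) (vsval y).
Proof. by rewrite vsprojK // form_closed ?subvsP. Qed.

Lemma vsvalD (x y : form_alg V) : vsval (x + y) = vsval x + vsval y.
Proof. by []. Qed.

Lemma vsvalZ (a : R) (x : form_alg V) : vsval (a *: x) = a *: vsval x.
Proof. by []. Qed.

Fact form_lie_linearl (a : R) (x y z : form_alg V) :
  form_lie (a *: x + y) z = a *: form_lie x z + form_lie y z.
Proof.
by apply: subvs_inj; rewrite vsvalD vsvalZ !form_lieE vsvalD vsvalZ lie_linearl.
Qed.

Fact form_lie_linearr (a : R) (x y z : form_alg V) :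
  form_lie x (a *: y + z) = a *: form_lie x y + form_lie x z.
Proof.
by apply: subvs_inj; rewrite vsvalD vsvalZ !form_lieE vsvalD vsvalZ lie_linearr.
Qed.

Fact form_liexx (x : form_alg V) : form_lie x x = 0.
Proof. by apply: subvs_inj; rewrite form_lieE liexx. Qed.

Fact form_lie_jacobi (x y z : form_alg V) :
  form_lie x (form_lie y z) + form_lie y (form_lie z x)
    + form_lie z (form_lie x y) = 0.
Proof. by apply: subvs_inj; rewrite !vsvalD !form_lieE lie_jacobi. Qed.

HB.instance Definition _ := Vector_isLieAlgebra.Build R (form_alg V)
  form_lie_linearl form_lie_linearr form_liexx form_lie_jacobi.

Lemma lie_formE (x y : form_alg V) : vsval (lie x y) = lie (vsval x) (vsval y).
Proof. exact: form_lieE. Qed.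

(* Every z : L is uniquely [incl (re z) + muli (incl (im z))]. *)
Definition incl : 'Hom(form_alg V, L) := linfun vsval.
Definition proj : 'Hom(L, form_alg V) := linfun (vsproj V).
Definition re : 'Hom(L, form_alg V) := (proj \o daddv_pi V (iL @: V))%VF.
Definition im : 'Hom(L, form_alg V) :=
  (proj \o (- iL) \o daddv_pi (iL @: V) V)%VF.

Definition conj_form : 'End(L) := ((incl \o re) - (iL \o incl \o im))%VF.

Definition extend (f : 'End(form_alg V)) : 'End(L) :=
  ((incl \o f \o re) + (iL \o incl \o f \o im))%VF.

(* The restriction to V of an endomorphism of L; meaningful when it maps V to
   itself. *)
Definition restrict (f : 'End(L)) : 'End(form_alg V) := (proj \o f \o incl)%VF.

Definition eigp (nu : 'End(form_alg V)) : {vspace L} :=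
  (incl @: passmx.leigenspace nu 1)%VS.
Definition eigm (nu : 'End(form_alg V)) : {vspace L} :=
  (incl @: passmx.leigenspace nu (-1))%VS.

Lemma inclE (x : form_alg V) : incl x = vsval x. Proof. by rewrite lfunE. Qed.

Lemma incl_in (x : form_alg V) : incl x \in V.
Proof. by rewrite inclE subvsP. Qed.

Lemma incl_inj : injective incl.
Proof. by move=> x y; rewrite !inclE => /subvs_inj. Qed.

Lemma incl0E x : (incl x == 0) = (x == 0).
Proof. by rewrite -(linear0 incl) (inj_eq incl_inj). Qed.

Lemma incl_lie (x y : form_alg V) : incl (lie x y) = lie (incl x) (incl y).
Proof. by rewrite !inclE lie_formE. Qed.

Lemma inclK (x : form_alg V) : proj (incl x) = x.
Proof. by rewrite inclE lfunE /= vsvalK. Qed.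

Lemma projK z : z \in V -> incl (proj z) = z.
Proof. by move=> zV; rewrite inclE lfunE /= vsprojK. Qed.

Lemma memVP z : reflect (exists x : form_alg V, z = incl x) (z \in V).
Proof.
by apply: (iffP idP) => [/projK <- | [x ->]]; [exists (proj z) | exact: incl_in].
Qed.

Lemma form_capC : (iL @: V :&: V = 0)%VS.
Proof. by rewrite capvC form_cap. Qed.

Lemma re_imK z : incl (re z) + iL (incl (im z)) = z.
Proof.
rewrite /re /im !comp_lfunE opp_lfunE !projK ?memv_pi //; last first.
  have /memv_imgP[y yV ->] := memv_pi (iL @: V) V z.
  by rewrite muliK opprK.
by rewrite linearN /= muliK opprK daddv_pi_add ?form_cap ?form_full ?memvf.
Qed.

Lemma formP (P : L -> Prop) :
  (forall x y : form_alg V, P (incl x + iL (incl y))) -> forall z, P z.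
Proof. by move=> PV z; rewrite -(re_imK z); exact: PV. Qed.

Lemma incl_eq0 x y : incl x + iL (incl y) = 0 -> x = 0 /\ y = 0.
Proof.
move=> /eqP; rewrite addr_eq0 => /eqP e.
have : incl x \in (V :&: iL @: V)%VS.
  by rewrite memv_cap incl_in e memvN memv_img ?incl_in.
rewrite form_cap memv0 => /eqP x0; split; first by apply: incl_inj; rewrite x0 linear0.
apply: incl_inj; rewrite linear0; apply: oppr_inj; rewrite -muliK oppr0.
by apply/eqP; rewrite -[iL (incl y)]opprK -e x0 oppr0 linear0.
Qed.

Lemma re_imE x y : re (incl x + iL (incl y)) = x /\ im (incl x + iL (incl y)) = y.
Proof.
set z := _ + _; have := re_imK z; rewrite {3}/z => /eqP.
rewrite -subr_eq0 opprD addrACA -!linearB /= => /eqP/incl_eq0[].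
by move=> /subr0_eq -> /subr0_eq ->.
Qed.

Lemma extendE f x y :
  extend f (incl x + iL (incl y)) = incl (f x) + iL (incl (f y)).
Proof.
have [ex ey] := re_imE x y.
rewrite /extend; move: (re) (im) ex ey => r i ex ey.
by rewrite add_lfunE !comp_lfunE ex ey.
Qed.

Lemma conjE x y : conj_form (incl x + iL (incl y)) = incl x - iL (incl y).
Proof.
have [ex ey] := re_imE x y.
rewrite /conj_form; move: (re) (im) ex ey => r i ex ey.
by rewrite add_lfunE opp_lfunE !comp_lfunE ex ey.
Qed.

Lemma extend_incl f x : extend f (incl x) = incl (f x).
Proof. by have := extendE f x 0; rewrite !linear0 !addr0. Qed.

Lemma conj_incl x : conj_form (incl x) = incl x.
Proof. by have := conjE x 0; rewrite !linear0 ?oppr0 !addr0. Qed.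

Lemma muli_form x y :
  iL (incl x + iL (incl y)) = incl (- y) + iL (incl x).
Proof. by rewrite linearD /= muliK linearN addrC. Qed.

Lemma extend_muli f z : extend f (iL z) = iL (extend f z).
Proof.
by elim/formP: z => x y; rewrite muli_form !extendE muli_form linearN.
Qed.

Lemma conj_muli z : conj_form (iL z) = - iL (conj_form z).
Proof.
elim/formP: z => x y.
by rewrite muli_form !conjE (linearN incl) linearB /= muliK opprK opprD addrC.
Qed.

Lemma extend_comp f h : extend (f \o h)%VF = (extend f \o extend h)%VF.
Proof.
apply/lfunP; elim/formP => x y.
by rewrite comp_lfunE !extendE !comp_lfunE.
Qed.

Lemma extend1 : extend \1%VF = \1%VF.
Proof. by apply/lfunP; elim/formP => x y; rewrite extendE !id_lfunE. Qed.

Lemma lie_mulir (x y : L) : lie x (iL y) = iL (lie x y).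
Proof. by rewrite lie_anti lie_mulil -linearN /= -lie_anti. Qed.

Lemma lie_muli2 (x y : L) : lie (iL x) (iL y) = - lie x y.
Proof. by rewrite lie_mulil lie_mulir muliK. Qed.

Lemma lie_form x y x' y' :
  lie (incl x + iL (incl y)) (incl x' + iL (incl y')) =
  incl (lie x x' - lie y y') + iL (incl (lie x y' + lie y x')).
Proof.
rewrite lieDl !linearD /= lie_muli2 lie_mulil lie_mulir -!incl_lie linearN /=.
by rewrite [X in _ + X = _]addrC addrACA.
Qed.

Lemma extend_lie (f : 'End(form_alg V)) :
  (forall x y : form_alg V, f (lie x y) = lie (f x) (f y)) ->
  forall z w : L, extend f (lie z w) = lie (extend f z) (extend f w).
Proof.
move=> fM; elim/formP => x y; elim/formP => x' y'.
rewrite lie_form (extendE f x) (extendE f x') extendE lie_form.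
by rewrite (linearB f) (linearD f) -!fM.
Qed.

Lemma conjNE x y : conj_form (incl x + iL (incl y)) = incl x + iL (incl (- y)).
Proof. by rewrite conjE (linearN incl) (linearN iL). Qed.

Lemma conj_lie z w : conj_form (lie z w) = lie (conj_form z) (conj_form w).
Proof.
elim/formP: z => x y; elim/formP: w => x' y'.
rewrite lie_form (conjNE x) (conjNE x') conjNE lie_form.
by rewrite !lieNl !(linearN (lie _)) opprK -opprD.
Qed.

Lemma conjK z : conj_form (conj_form z) = z.
Proof. by elim/formP: z => x y; rewrite !conjNE opprK. Qed.

Lemma extend_conj f z : extend f (conj_form z) = conj_form (extend f z).
Proof.
by elim/formP: z => x y; rewrite conjNE !extendE conjNE (linearN f).
Qed.

Lemma re_incl x : re (incl x) = x.
Proof. by have := (re_imE x 0).1; rewrite !linear0 addr0. Qed.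

Lemma im_muli x : im (iL (incl x)) = x.
Proof. by have := (re_imE 0 x).2; rewrite linear0 add0r. Qed.

Lemma im_incl x : im (incl x) = 0.
Proof. by have := (re_imE x 0).2; rewrite !linear0 addr0. Qed.

Lemma re_muli x : re (iL (incl x)) = 0.
Proof. by have := (re_imE 0 x).1; rewrite linear0 add0r. Qed.

Lemma lftrace_split (F : 'End(L)) :
  lftrace F =
  lftrace (re \o (F \o incl))%VF + lftrace (im \o (F \o (iL \o incl)))%VF.
Proof.
rewrite -(lftrace_comp (F \o incl)%VF) -(lftrace_comp (F \o (iL \o incl))%VF).
rewrite -lftraceD; congr lftrace; apply/lfunP => z.
rewrite add_lfunE; move: (re) (im) (re_imK z) => r i e.
by rewrite !comp_lfunE -(linearD F) e.
Qed.

Lemma lftrace_form (F : 'End(L)) (G : 'End(form_alg V)) :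
  (forall z, F (iL z) = iL (F z)) -> (forall x, F (incl x) = incl (G x)) ->
  lftrace F = lftrace G *+ 2.
Proof.
move=> FJ FG; rewrite lftrace_split mulr2n; congr (_ + _); congr lftrace.
  apply/lfunP => x; move: (re) re_incl => r rE.
  by rewrite !comp_lfunE FG rE.
apply/lfunP => x; move: (im) im_muli => r rE.
by rewrite !comp_lfunE FJ FG rE.
Qed.

Lemma lftrace_muli (F : 'End(L)) (G : 'End(form_alg V)) :
  (forall z, F (iL z) = iL (F z)) -> (forall x, F (incl x) = incl (G x)) ->
  lftrace (iL \o F)%VF = 0.
Proof.
move=> FJ FG; rewrite lftrace_split -[RHS]addr0.
congr (_ + _); rewrite -[RHS](lftrace0 (form_alg V)); congr lftrace.
  apply/lfunP => x; move: (re) re_muli => r rE.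
  by rewrite !comp_lfunE FG zero_lfunE rE.
apply/lfunP => x; move: (im) im_incl => r rE.
rewrite !comp_lfunE FJ FG muliK (linearN r) zero_lfunE.
by apply/eqP; rewrite oppr_eq0; apply/eqP; exact: rE.
Qed.

Lemma killing_form x y : killing (incl x) (incl y) = killing x y *+ 2.
Proof.
apply: lftrace_form => [z|z]; rewrite !comp_lfunE !adE ?lie_mulir //.
by rewrite -!incl_lie.
Qed.

Lemma killing_incl_muli x y : killing (incl x) (iL (incl y)) = 0.
Proof.
rewrite -(@lftrace_muli (ad (incl x) \o ad (incl y))%VF (ad x \o ad y)%VF).
- congr lftrace; apply/lfunP => z.
  by rewrite !comp_lfunE !adE lie_mulil lie_mulir.
- by move=> z; rewrite !comp_lfunE !adE !lie_mulir.
- by move=> z; rewrite !comp_lfunE !adE -!incl_lie.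
Qed.

Lemma killing_muli2 (z w : L) : killing (iL z) (iL w) = - killing z w.
Proof.
rewrite /killing -lftraceN; congr lftrace; apply/lfunP => v.
by rewrite opp_lfunE !comp_lfunE !adE !lie_mulil lie_mulir muliK.
Qed.

Lemma extend_conj_neg theta :
  cartan_involution theta ->
  forall z, z != 0 -> 0 < - killing z (extend theta (conj_form z)).
Proof.
move=> [_ neg]; elim/formP => x y z0.
rewrite conjNE extendE (linearN theta) (linearN incl) (linearN iL).
rewrite killingDl !killingDr !killingNr killing_muli2 opprK.
rewrite [killing (iL _) _]killingC !killing_incl_muli !killing_form.
rewrite oppr0 addr0 add0r opprD -!mulNrn -mulrnDl pmulrn_lgt0 //.
have [x0|x0] := eqVneq x 0; last first.
  rewrite ltr_wpDr ?neg //; have [->|/neg/ltW //] := eqVneq y 0.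
  by rewrite (linear0 theta) killing0r oppr0.
have [y0|y0] := eqVneq y 0; first by rewrite x0 y0 !linear0 addr0 eqxx in z0.
rewrite ltr_wpDl ?neg //.
by rewrite x0 (linear0 theta) killing0r oppr0.
Qed.

Section Stable.
Variable F : 'End(L).
Hypothesis FV : forall z, z \in V -> F z \in V.

Lemma restrict_incl x : incl (restrict F x) = F (incl x).
Proof. by rewrite !comp_lfunE projK // FV ?incl_in. Qed.

Lemma extend_restrict :
  (forall z, F (iL z) = iL (F z)) -> extend (restrict F) = F.
Proof.
move=> FJ; apply/lfunP; elim/formP => x y.
by rewrite extendE !restrict_incl (linearD F) /= FJ.
Qed.

Lemma restrict_involution : involution F -> involution (restrict F).
Proof.
move=> [FM FK]; split=> [x y|].
  by apply: incl_inj; rewrite restrict_incl !incl_lie FM !restrict_incl.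
apply/lfunP => x; apply: incl_inj; rewrite comp_lfunE !restrict_incl.
by rewrite -comp_lfunE FK !id_lfunE.
Qed.

Lemma restrict_comp (G : 'End(L)) :
  (restrict G \o restrict F)%VF = restrict (G \o F)%VF.
Proof.
apply/lfunP => x; rewrite comp_lfunE /restrict; move: restrict_incl => e.
by rewrite 2![LHS]comp_lfunE e !comp_lfunE.
Qed.

End Stable.

Lemma restrict_extend f : restrict (extend f) = f.
Proof.
apply/lfunP => x; apply: incl_inj; rewrite restrict_incl ?extend_incl // => z.
by case/memVP => y ->; rewrite extend_incl incl_in.
Qed.

End FormLie.

Arguments incl {V}.

(* The fixed point sets of these maps are the real forms of L, see
   [real_form_fixed]. *)
Definition conjugation (t : 'End(L)) :=
  involution t /\ forall z, t (iL z) = - iL (t z).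

Lemma conj_formP V : conjugation (conj_form V).
Proof.
split; last exact: conj_muli; split; first exact: conj_lie.
by apply/lfunP => z; rewrite comp_lfunE conjK id_lfunE.
Qed.

Lemma involutionE (g : lieAlgType R) (f : 'End(g)) x :
  involution f -> f (f x) = x.
Proof. by case=> _ fK; rewrite -comp_lfunE fK id_lfunE. Qed.

Lemma real_form_fixed t : conjugation t -> is_real_form (fixedSpace t).
Proof.
move=> [ti tJ]; have tM := ti.1; apply/and3P; split.
- apply/lie_prodP => x y /fixedSpaceP xt /fixedSpaceP yt.
  by apply/fixedSpaceP; rewrite tM xt yt.
- rewrite eqEsubv subvf; apply/subvP => z _.
  have tt := involutionE z ti.
  pose u := 2^-1 *: (z + t z); pose v := 2^-1 *: iL (t z - z).
  have -> : z = u + iL v.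
    rewrite /u /v linearZ /= muliK opprB -scalerDr.
    by rewrite addrACA subrr addr0 -mulr2n -scaler_nat scalerA mulVf ?scale1r ?pnatr_eq0.
  rewrite memv_add ?memv_img //; apply/fixedSpaceP.
    by rewrite /u linearZ /= linearD /= tt addrC.
  by rewrite /v linearZ /= tJ linearB /= tt -(linearN iL) /= opprB.
- rewrite -subv0; apply/subvP => z; rewrite memv_cap memv0.
  case/andP => /fixedSpaceP zt /memv_imgP[y /fixedSpaceP yt zE].
  have : z = - z by rewrite -{1}zt zE tJ yt.
  move/eqP; rewrite -addr_eq0 -mulr2n -scaler_nat scaler_eq0 pnatr_eq0 /=.
  by [].
Qed.

Lemma conj_form_unique (U : realForm) t :
  conjugation t -> U = fixedSpace t :> {vspace L} -> conj_form U = t.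
Proof.
move=> [_ tJ] Ut.
have tU (x : form_alg U) : t (incl x) = incl x.
  by apply/fixedSpaceP; rewrite -Ut incl_in.
by apply/lfunP; elim/(@formP U) => x y; rewrite conjE linearD /= tJ !tU.
Qed.

Section ExtendConj.
Variables (V : realForm) (f : 'End(form_alg V)).

Lemma extend_involution : involution f -> involution (extend f).
Proof.
by move=> [fM fK]; split; [exact: extend_lie | rewrite -extend_comp fK extend1].
Qed.

Lemma comp_conjugation (t F : 'End(L)) :
  conjugation t -> involution F -> (forall z, F (iL z) = iL (F z)) ->
  (F \o t = t \o F)%VF -> conjugation (F \o t)%VF.
Proof.
move=> [ti tJ] Fi FJ Ft; split; last first.
  by move=> z; rewrite !comp_lfunE tJ linearN /= FJ.
split=> [x y|]; first by rewrite !comp_lfunE ti.1 Fi.1.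
apply/lfunP => z; rewrite {1}Ft !comp_lfunE id_lfunE.
by rewrite (involutionE _ Fi) (involutionE _ ti).
Qed.

Lemma extend_conjugation :
  involution f -> conjugation (extend f \o conj_form V)%VF.
Proof.
move=> fi; apply: comp_conjugation; first exact: conj_formP.
- exact: extend_involution.
- exact: extend_muli.
by apply/lfunP => z; rewrite !comp_lfunE extend_conj.
Qed.

End ExtendConj.

End RealForm.
Arguments incl {R L V}.
Arguments conj_form {R L} V.
Arguments restrict {R L} V f.

(* The pair (x, y) stands for x + i y. Every real Lie algebra g is thus a real
   form of a complex Lie algebra, see [cplx_form_iso]. *)
Section Complexification.
Variables (R : realType) (g : lieAlgType R).

Definition cplx : Type := (g * g)%type.
HB.instance Definition _ := Vector.on cplx.

Definition cplx_lie (z w : cplx) : cplx :=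
  (lie z.1 w.1 - lie z.2 w.2, lie z.1 w.2 + lie z.2 w.1).

Lemma cplx_eq (z w : cplx) : z.1 = w.1 -> z.2 = w.2 -> z = w.
Proof. by case: z w => [? ?] [? ?] /= -> ->. Qed.

Fact cplx_lie_linearr (a : R) (x y z : cplx) :
  cplx_lie x (a *: y + z) = a *: cplx_lie x y + cplx_lie x z.
Proof.
apply: cplx_eq; rewrite /= !lie_linearr ?scalerBr ?scalerDr ?opprD addrACA //.
Qed.

Fact cplx_lie_linearl (a : R) (x y z : cplx) :
  cplx_lie (a *: x + y) z = a *: cplx_lie x z + cplx_lie y z.
Proof.
apply: cplx_eq; rewrite /= !lie_linearl ?scalerBr ?scalerDr ?opprD addrACA //.
Qed.

Fact cplx_liexx (x : cplx) : cplx_lie x x = 0.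
Proof.
by apply: cplx_eq; rewrite /= ?liexx ?subrr // [X in _ + X]lie_anti subrr.
Qed.

Fact cplx_lie_jacobi (x y z : cplx) :
  cplx_lie x (cplx_lie y z) + cplx_lie y (cplx_lie z x)
    + cplx_lie z (cplx_lie x y) = 0.
Proof.
apply: cplx_eq => /=; rewrite !linearB !linearD /= ?opprD !addrA.
  rewrite [LHS](AC 12 ((1*5*9)*(2*8*11)*(3*6*12)*(4*7*10))) /=.
  by rewrite -!opprD !lie_jacobi !subr0.
rewrite [LHS](AC 12 ((1*6*11)*(2*7*9)*(3*5*10)*(4*8*12))) /=.
by rewrite -!opprD !lie_jacobi subr0 !addr0.
Qed.

HB.instance Definition _ := Vector_isLieAlgebra.Build R cplx
  cplx_lie_linearl cplx_lie_linearr cplx_liexx cplx_lie_jacobi.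

Definition cplx_muli_fun (z : cplx) : cplx := (- z.2, z.1).

Fact cplx_muli_linear : linear cplx_muli_fun.
Proof. by move=> a z w; apply: cplx_eq; rewrite //= scalerN opprD. Qed.
HB.instance Definition _ := GRing.isSemilinear.Build R cplx cplx _
  cplx_muli_fun (GRing.semilinear_linear cplx_muli_linear).

Definition cplx_muli : 'End(cplx) := linfun cplx_muli_fun.

Fact cplx_muliK (z : cplx) : cplx_muli (cplx_muli z) = - z.
Proof. by rewrite !lfunE; apply: cplx_eq. Qed.

Fact cplx_lie_mulil (z w : cplx) : lie (cplx_muli z) w = cplx_muli (lie z w).
Proof.
rewrite !lfunE; apply: cplx_eq; rewrite /= lieNl; last by rewrite addrC.
by rewrite opprD addrC.
Qed.

HB.instance Definition _ := LieAlgebra_isComplex.Build R cplx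
  cplx_muliK cplx_lie_mulil.

Definition cplx_in_fun (x : g) : cplx := (x, 0).
Fact cplx_in_linear : linear cplx_in_fun.
Proof. by move=> a x y; apply: cplx_eq; rewrite //= scaler0 addr0. Qed.
HB.instance Definition _ := GRing.isSemilinear.Build R g cplx _
  cplx_in_fun (GRing.semilinear_linear cplx_in_linear).

Definition cplx_in : 'Hom(g, cplx) := linfun cplx_in_fun.

Lemma cplx_in_lie x y : cplx_in (lie x y) = lie (cplx_in x) (cplx_in y).
Proof.
by rewrite !lfunE; apply: cplx_eq; rewrite /= !lie0l ?subr0 // linear0 addr0.
Qed.

Lemma cplx_in_real_form : is_real_form (limg cplx_in).
Proof.
apply/and3P; split.
- apply/lie_prodP => _ _ /memv_imgP[x _ ->] /memv_imgP[y _ ->].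
  by rewrite -cplx_in_lie memv_img ?memvf.
- rewrite eqEsubv subvf; apply/subvP => z _.
  have -> : z = cplx_in z.1 + muli (cplx_in z.2).
    by rewrite !lfunE; apply: cplx_eq; rewrite /= ?lfunE /= ?oppr0 ?addr0 ?add0r.
  by rewrite memv_add ?memv_img ?memvf.
rewrite -subv0; apply/subvP => z; rewrite memv_cap memv0.
case/andP => /memv_imgP[x _ zx] /memv_imgP[_ /memv_imgP[y _ ->] zy].
have zx' : z = (x, 0) :> cplx by rewrite zx lfunE.
have zy' : z = (- 0, y) :> cplx by rewrite zy !lfunE.
move: zy'; rewrite zx' oppr0 => -[-> _].
by [].
Qed.

Definition cplx_form : realForm cplx := RealForm cplx_in_real_form.

Lemma cplx_form_iso : exists f : g -> form_alg cplx_form,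
  [/\ linear f, bijective f & forall x y, f (lie x y) = lie (f x) (f y)].
Proof.
have inV x : cplx_in x \in cplx_form by rewrite memv_img ?memvf.
exists (fun x => proj cplx_form (cplx_in x)).
have fK x : vsval (proj cplx_form (cplx_in x)) = cplx_in x.
  by rewrite -inclE projK.
split.
- by move=> a x y; rewrite !linearP.
- exists (fun v => (vsval v : cplx).1) => [x|v]; first by rewrite fK lfunE.
  apply: subvs_inj; rewrite fK; have /memv_imgP[x _ ->] := subvsP v.
  by rewrite !lfunE.
move=> x y; apply: subvs_inj; rewrite lie_formE !fK; exact: cplx_in_lie.
Qed.

End Complexification.

Arguments semisimple {K} g.

Section Duality.
Variables (R : realType) (L : complexLieAlgType R).
Local Notation iL := (@muli R L).

(* Semisimple symmetric pairs equipped with a Cartan involution whose Lie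
   algebra is a real form of L, so that L is its complexification.
   Non-compactness is not part of the record: for sigma = id the dual pair of
   a non-compact pair is compact. *)
Record symPair := SymPair {
  pair_form : realForm L;
  sigma : 'End(form_alg pair_form);
  theta : 'End(form_alg pair_form);
  _ : semisimple (form_alg pair_form);
  _ : involution sigma;
  _ : cartan_involution theta;
  _ : (theta \o sigma = sigma \o theta)%VF
}.

Record symTriad := SymTriad {
  triad_form : realForm L;
  theta1 : 'End(form_alg triad_form);
  theta2 : 'End(form_alg triad_form);
  _ : semisimple (form_alg triad_form);
  _ : compact_lie (form_alg triad_form);
  _ : involution theta1;
  _ : involution theta2;
  _ : (theta1 \o theta2 = theta2 \o theta1)%VF
}.

Lemma compact_semisimple (g : lieAlgType R) : compact_lie g -> semisimple g.
Proof.
move=> cg; apply: nondegenerate_semisimple => x /cg xx.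
by exists x; rewrite lt_eqF.
Qed.

Lemma cartan_semisimple (g : lieAlgType R) (th : 'End(g)) :
  cartan_involution th -> semisimple g.
Proof.
move=> [_ thP]; apply: nondegenerate_semisimple => x /thP xx.
by exists (th x); rewrite lt_eqF // -oppr_gt0.
Qed.

Lemma involution_comp (g : lieAlgType R) (f h : 'End(g)) :
  involution f -> involution h -> (f \o h = h \o f)%VF -> involution (f \o h)%VF.
Proof.
move=> fi hi fh; split=> [x y|]; first by rewrite !comp_lfunE hi.1 fi.1.
apply/lfunP => x; rewrite {1}fh !comp_lfunE id_lfunE.
by rewrite (involutionE _ fi) (involutionE _ hi).
Qed.

Lemma comm_comp (g : lieAlgType R) (f h : 'End(g)) :
  (f \o h = h \o f)%VF -> (f \o (f \o h) = (f \o h) \o f)%VF.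
Proof. by move=> e; rewrite -comp_lfunA -e. Qed.

Section CompactDual.
Variables (V : realForm L) (th : 'End(form_alg V)).
Hypothesis thP : involution th.

Definition compact_dual_space : {vspace L} := (eigp th + iL @: eigm th)%VS.

Lemma compact_dual_fixed :
  compact_dual_space = fixedSpace (extend th \o conj_form V)%VF.
Proof.
have eigP a x : (x \in passmx.leigenspace th a) = (th x == a *: x).
  rewrite memv_ker add_lfunE opp_lfunE scale_lfunE id_lfunE subr_eq0 //.
apply/vspaceP => z; apply/memv_addP/fixedSpaceP.
  case=> _ /memv_imgP[x xE ->] [_ /memv_imgP[_ /memv_imgP[y yE ->] ->] ->].
  move: xE yE; rewrite !eigP scale1r scaleN1r => /eqP xE /eqP yE.
  by rewrite comp_lfunE conjNE extendE (linearN th) /= xE yE opprK.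
elim/(@formP _ _ V): z => x y; rewrite comp_lfunE conjNE extendE => /eqP.
rewrite -subr_eq0 opprD addrACA -!linearB /= => /eqP/incl_eq0[].
rewrite (linearN th) /= => /subr0_eq xE /subr0_eq yE.
exists (incl x); first by rewrite memv_img // eigP scale1r xE.
exists (iL (incl y)) => //.
by rewrite !memv_img // eigP scaleN1r -[X in _ == - X]yE opprK.
Qed.

Lemma compact_dual_real_form : is_real_form compact_dual_space.
Proof.
by rewrite compact_dual_fixed; apply/real_form_fixed/extend_conjugation.
Qed.

Definition compact_dual : realForm L := RealForm compact_dual_real_form.

Lemma conj_compact_dual :
  conj_form compact_dual = (extend th \o conj_form V)%VF.
Proof.
apply: conj_form_unique; last exact: compact_dual_fixed.
exact: extend_conjugation.
Qed.

Lemma extend_conj_comm (f : 'End(form_alg V)) : (th \o f = f \o th)%VF ->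
  forall z, conj_form compact_dual (extend f z)
            = extend f (conj_form compact_dual z).
Proof.
move=> e z; rewrite conj_compact_dual !comp_lfunE -extend_conj.
by rewrite -!comp_lfunE -!extend_comp e.
Qed.

Lemma compact_dual_stable (f : 'End(form_alg V)) : (th \o f = f \o th)%VF ->
  forall z, z \in compact_dual -> extend f z \in compact_dual.
Proof.
move=> e z; rewrite /= {1 2}compact_dual_fixed -conj_compact_dual.
by move=> /fixedSpaceP zf; apply/fixedSpaceP; rewrite extend_conj_comm // zf.
Qed.

End CompactDual.

Lemma compact_dual_compact (V : realForm L) (th : 'End(form_alg V))
  (thP : cartan_involution th) : compact_lie (form_alg (compact_dual thP.1)).
Proof.
move=> x x0; rewrite -(pmulrn_llt0 _ (ltn0Sn 1)) -killing_form.
have z0 : incl x != 0 by rewrite incl0E.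
have := extend_conj_neg thP z0; rewrite oppr_gt0 -comp_lfunE.
by rewrite -(conj_compact_dual thP.1) conj_incl.
Qed.

Lemma symPair_semisimple x : semisimple (form_alg (pair_form x)).
Proof. by case: x. Qed.
Lemma sigmaP x : involution (sigma x). Proof. by case: x. Qed.
Lemma thetaP x : cartan_involution (theta x). Proof. by case: x. Qed.
Lemma thetaC x : (theta x \o sigma x = sigma x \o theta x)%VF.
Proof. by case: x. Qed.

Lemma symTriad_semisimple y : semisimple (form_alg (triad_form y)).
Proof. by case: y. Qed.
Lemma symTriad_compact y : compact_lie (form_alg (triad_form y)).
Proof. by case: y. Qed.
Lemma theta1P y : involution (theta1 y). Proof. by case: y. Qed.
Lemma theta2P y : involution (theta2 y). Proof. by case: y. Qed.
Lemma theta12C y : (theta1 y \o theta2 y = theta2 y \o theta1 y)%VF.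
Proof. by case: y. Qed.

Definition pair_assoc (x : symPair) : symPair :=
  @SymPair (pair_form x) (theta x \o sigma x)%VF (theta x)
    (@symPair_semisimple x)
    (involution_comp (thetaP x).1 (sigmaP x) (thetaC x))
    (thetaP x) (comm_comp (thetaC x)).

Definition triad_assoc (y : symTriad) : symTriad :=
  @SymTriad (triad_form y) (theta1 y) (theta1 y \o theta2 y)%VF
    (@symTriad_semisimple y) (@symTriad_compact y) (theta1P y)
    (involution_comp (theta1P y) (theta2P y) (theta12C y))
    (comm_comp (theta12C y)).

Definition triad_dual (y : symTriad) : symTriad :=
  @SymTriad (triad_form y) (theta2 y) (theta1 y)
    (@symTriad_semisimple y) (@symTriad_compact y) (theta2P y) (theta1P y)
    (esym (theta12C y)).

Section Star.
Variable x : symPair.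
Let u := compact_dual (thetaP x).1.

Lemma star_theta_involution : involution (restrict u (extend (theta x))).
Proof.
apply: restrict_involution; last exact: extend_involution (thetaP x).1.
exact: compact_dual_stable.
Qed.

Lemma star_sigma_involution : involution (restrict u (extend (sigma x))).
Proof.
apply: restrict_involution; last exact: extend_involution (sigmaP x).
exact: compact_dual_stable (thetaC x).
Qed.

Lemma star_comm :
  (restrict u (extend (theta x)) \o restrict u (extend (sigma x)) =
   restrict u (extend (sigma x)) \o restrict u (extend (theta x)))%VF.
Proof.
rewrite !restrict_comp -?extend_comp ?(thetaC x) //.
  exact: compact_dual_stable.
exact: compact_dual_stable (thetaC x).
Qed.

Definition star : symTriad :=
  @SymTriad u (restrict u (extend (theta x))) (restrict u (extend (sigma x)))
    (compact_semisimple (@compact_dual_compact _ _ (thetaP x)))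
    (@compact_dual_compact _ _ (thetaP x))
    star_theta_involution star_sigma_involution star_comm.

End Star.

Section Dual.
Variable x : symPair.
Let mu := conj_form (compact_dual (thetaP x).1).

Definition dual_space : {vspace L} := fixedSpace (mu \o extend (sigma x))%VF.

Lemma mu_comm (f : 'End(form_alg (pair_form x))) :
  (theta x \o f = f \o theta x)%VF ->
  (mu \o extend f = extend f \o mu)%VF.
Proof.
by move=> e; apply/lfunP => z; rewrite !comp_lfunE; exact: extend_conj_comm.
Qed.

Lemma dual_real_form : is_real_form dual_space.
Proof.
apply: real_form_fixed; rewrite (mu_comm (thetaC x)); apply: comp_conjugation.
- exact: conj_formP.
- exact: extend_involution (sigmaP x).
- exact: extend_muli.
by rewrite (mu_comm (thetaC x)).
Qed.

Definition dual_form : realForm L := RealForm dual_real_form.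

Lemma dual_stable (f : 'End(form_alg (pair_form x))) :
  (theta x \o f = f \o theta x)%VF -> (sigma x \o f = f \o sigma x)%VF ->
  forall z, z \in dual_form -> extend f z \in dual_form.
Proof.
move=> tf sf z /fixedSpaceP; rewrite comp_lfunE => zf; apply/fixedSpaceP.
rewrite comp_lfunE -[extend (sigma x) _]comp_lfunE -extend_comp sf extend_comp.
by rewrite comp_lfunE -comp_lfunE (mu_comm tf) comp_lfunE zf.
Qed.

Let sigma_stable := dual_stable (thetaC x) erefl.
Let theta_stable := dual_stable erefl (esym (thetaC x)).

Lemma dual_theta_involution :
  involution (restrict dual_form (extend (theta x))).
Proof.
by apply: restrict_involution; [|exact: extend_involution (thetaP x).1].
Qed.

Lemma dual_sigma_cartan :
  cartan_involution (restrict dual_form (extend (sigma x))).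
Proof.
split; first by apply: restrict_involution; [|exact: extend_involution (sigmaP x)].
move=> w w0; rewrite -(pmulrn_lgt0 _ (ltn0Sn 1)) mulNrn -killing_form.
rewrite restrict_incl //.
have z0 : incl w != 0 by rewrite incl0E.
have := extend_conj_neg (thetaP x) z0; rewrite -comp_lfunE.
rewrite -(conj_compact_dual (thetaP x).1) -/mu.
suff -> : mu (incl w) = extend (sigma x) (incl w) by [].
have /fixedSpaceP : incl w \in dual_form by exact: incl_in.
rewrite comp_lfunE => zf.
by rewrite -{1}zf (involutionE _ (conj_formP _).1).
Qed.

Lemma dual_comm :
  (restrict dual_form (extend (sigma x)) \o
     restrict dual_form (extend (theta x)) =
   restrict dual_form (extend (theta x)) \o
     restrict dual_form (extend (sigma x)))%VF.
Proof. by rewrite !restrict_comp -?extend_comp ?(thetaC x). Qed.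

Definition pair_dual : symPair :=
  @SymPair dual_form (restrict dual_form (extend (theta x)))
    (restrict dual_form (extend (sigma x)))
    (cartan_semisimple dual_sigma_cartan) dual_theta_involution
    dual_sigma_cartan dual_comm.

End Dual.
End Duality.

(* Main.v *)
Require Import Defs.
From mathcomp Require Import all_boot all_order all_algebra.
From mathcomp Require Import boolp reals.

Set Implicit Arguments.
Unset Strict Implicit.
Unset Printing Implicit Defensive.

(** Everything takes place in the fixed complex Lie algebra [L].  A real form of
    [L] is the same thing as the complex conjugation whose fixed points it is,
    and an involution of a real form is the same thing as its complex linear
    extension to [L].  A pair is thus a triple of commuting maps
    [(c, s; t)] of [L], with [c] antilinear, and a triad is a triple
    [(m, t1, t2)]; see [symTriad_eq] for the fact that nothing is lost.

    In these coordinates [star] sends [(c, s; t)] to [(t c, t, s)], and the dual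
    pair of [(c, s; t)] is [(m s, t; s)] with [m = t c].  The associated pair
    only replaces [s] by [t s], hence
    - [a*] and [*a] both give [(t c, t, t s)];
    - [d*] gives [(s (m s), s, t)], which is [(m, s, t)] because [s] is an
      involution commuting with [m], and this is also [*d].

    That the triples are these is not immediate, since in the definitions the
    involutions are restrictions of extensions to another real form; it is the
    content of [conj_form_star],
    [extend_theta1_star], [extend_theta2_star], [conj_form_dual],
    [extend_sigma_dual] and [extend_theta_dual]. *)

Import GRing.Theory.
Local Open Scope ring_scope.

Section RealFormConjugation.
Variables (R : realType) (L : complexLieAlgType R).

Lemma real_form_fixedE (V : realForm L) :
  V = fixedSpace (conj_form V) :> {vspace L}.
Proof.
apply/vspaceP => z; apply/idP/fixedSpaceP => [/memVP[x ->]|].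
  exact: conj_incl.
elim/(@formP _ _ V): z => x y; rewrite conjE => /eqP.
(* If x + i y is a fixed point, then 2 i y = 0. *)
rewrite (inj_eq (addrI _)) eq_sym -addr_eq0 -mulr2n -scaler_nat scaler_eq0.
rewrite Num.Theory.pnatr_eq0 /= => /eqP ->.
by rewrite addr0 incl_in.
Qed.

Lemma conj_form_inj : injective (@conj_form R L).
Proof.
move=> V W VW; have := real_form_fixedE V; rewrite VW -real_form_fixedE.
case: V W {VW} => V Vr [W Wr] /= VW; move: Vr; rewrite VW => Vr.
by congr RealForm; exact: bool_irrelevance.
Qed.

End RealFormConjugation.

Section Duality.
Variables (R : realType) (L : complexLieAlgType R).
Implicit Types (x : symPair L) (y : symTriad L).

(** Comparing the two involutions only after extension to [L] avoids transporting
    them along the equality of the underlying real forms. *)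
Lemma symTriad_eq y y' :
  conj_form (triad_form y) = conj_form (triad_form y') ->
  extend (theta1 y) = extend (theta1 y') ->
  extend (theta2 y) = extend (theta2 y') -> y = y'.
Proof.
case: y y' => U t1 t2 ss c i1 i2 e [U' t1' t2' ss' c' i1' i2' e'] /=.
move=> /conj_form_inj UU'; case: U' / UU' t1' t2' ss' c' i1' i2' e'.
move=> t1' t2' ss' c' i1' i2' e' E1 E2.
have {}E1 : t1 = t1' by rewrite -(restrict_extend t1) E1 restrict_extend.
have {}E2 : t2 = t2' by rewrite -(restrict_extend t2) E2 restrict_extend.
case: t1' / E1 i1' e' => i1' e'; case: t2' / E2 i2' e' => i2' e'.
by congr SymTriad; exact: Prop_irrelevance.
Qed.

Lemma extend_theta1_star x : extend (theta1 (star x)) = extend (theta x).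
Proof.
apply: extend_restrict; last exact: extend_muli.
exact: compact_dual_stable.
Qed.

Lemma extend_theta2_star x : extend (theta2 (star x)) = extend (sigma x).
Proof.
apply: extend_restrict; last exact: extend_muli.
exact: compact_dual_stable (thetaC x).
Qed.

Lemma conj_form_star x :
  conj_form (triad_form (star x)) =
  (extend (theta x) \o conj_form (pair_form x))%VF.
Proof. exact: conj_compact_dual. Qed.

Lemma conj_form_dual x :
  conj_form (pair_form (pair_dual x)) =
  (extend (sigma x) \o conj_form (triad_form (star x)))%VF.
Proof.
have sm := mu_comm (thetaC x).
apply: conj_form_unique; last by rewrite -sm.
apply: comp_conjugation.
- exact: conj_formP.
- exact: extend_involution (sigmaP x).
- exact: extend_muli.
- exact: esym sm.
Qed.

Lemma extend_sigma_dual x : extend (sigma (pair_dual x)) = extend (theta x).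
Proof.
apply: extend_restrict; last exact: extend_muli.
exact: dual_stable erefl (esym (thetaC x)).
Qed.

Lemma extend_theta_dual x : extend (theta (pair_dual x)) = extend (sigma x).
Proof.
apply: extend_restrict; last exact: extend_muli.
exact: dual_stable (thetaC x) erefl.
Qed.

Lemma star_assoc x : star (pair_assoc x) = triad_assoc (star x).
Proof.
apply: symTriad_eq.
- by rewrite [LHS]conj_form_star [RHS]conj_form_star.
- by rewrite [LHS]extend_theta1_star [RHS]extend_theta1_star.
rewrite [LHS]extend_theta2_star [LHS]extend_comp [RHS]extend_comp.
by rewrite extend_theta1_star extend_theta2_star.
Qed.

Lemma star_dual x : star (pair_dual x) = triad_dual (star x).
Proof.
apply: symTriad_eq.
- rewrite [LHS]conj_form_star extend_theta_dual conj_form_dual comp_lfunA.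
  by rewrite -extend_comp (sigmaP x).2 extend1 comp_lfun1l.
- by rewrite extend_theta1_star extend_theta_dual [RHS]extend_theta2_star.
by rewrite extend_theta2_star extend_sigma_dual [RHS]extend_theta1_star.
Qed.

End Duality.

Theorem proposition3p12 (R : realType) (L : complexLieAlgType R)
    (x : symPair L) (x_noncompact : ~ compact_lie (form_alg (pair_form x))) :
  star (pair_assoc x) = triad_assoc (star x) /\
  star (pair_dual x) = triad_dual (star x).
Proof. by split; [exact: star_assoc | exact: star_dual]. Qed.
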